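(* Consider a processing chain ($B$, $L$, $M_j$, $N_j$, $T_j$, $c_j$, $g_j$, $k_j$ with stride products $k_j^*$) whose application in a strided fashion is well-defined. Further assume that $\dim_{M_L}(\mathrm{EvalStride}_L(\rho))=1$ for all $\rho\in M_0^B$. For $\xi\in\cup_B(M_0)$ with $\delta:=\dim_{M_0}(\xi)$ let $r(\xi):=0$ if $k_L^*$ divides $\delta-B+1$, and $r(\xi):=k_L^*-\mathrm{rem}(\delta-B+1,\,k_L^* )$ otherwise. Consider $T\colon\cup_B(M_0)\to\cup_1(M_L)$, $$T(\xi):=\mathrm{Trim}_{r(\xi)}\Big(\mathrm{Defrag}_{k_L^*}\big(\mathrm{EvalSlide}_L(\mathrm{Stuff}_{r(\xi)}(\xi))\big)\Big).$$ Then $T$ is (well-defined and) a subsignal compatible transformation with dimensionality reduction constant $B$. Furthermore, $T(\rho)=\mathrm{EvalStride}_L(\rho)$ for all $\rho\in M_0^B$, and $T=\mathrm{Slide}_{\mathrm{EvalStride}_L}$.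
   Context: $\mathbb{N}=\{0,1,2,\dots\}$, $\mathbb{N}_1=\mathbb{N}\setminus\{0\}$; $\{a,\dots,b\}$ is a set of integers (empty if $b<a$). Elements of $M^q$ are signals with $q$ samples, $\dim_M(\xi)=q$ for $\xi\in M^q$, $\cup_c(M):=\bigcup_{q\ge c}M^q$; $M^1$ is identified with $M$. For $a\in\mathbb{N}$, $b\in\mathbb{N}_1$, $\mathrm{div}(a,b)$ and $\mathrm{rem}(a,b)\in\{0,\dots,b-1\}$ denote Euclidean quotient and remainder. $\mathrm{Subsignal}_d(\xi,i):=(\xi_i,\dots,\xi_{i+d-1})$ for $i\in\{1,\dots,\dim_M(\xi)-d+1\}$. A function $T\colon\cup_c(M)\to\cup_1(N)$ is a subsignal compatible transformation with dimensionality reduction constant $c\in\mathbb{N}_1$ iff $\dim_N(T(\xi))=\dim_M(\xi)-c+1$ for all $\xi\in\cup_c(M)$, and for all $d\ge c$, $\xi\in\cup_d(M)$, $i\in\{1,\dots,\dim_M(\xi)-d+1\}$: $T(\mathrm{Subsignal}_d(\xi,i))=\mathrm{Subsignal}_{d-c+1}(T(\xi),i)$. For $f\colon M^c\to N$, $\mathrm{Slide}_f\colon\cup_c(M)\to\cup_1(N)$, $\mathrm{Slide}_f(\xi)_i:=f(\mathrm{Subsignal}_c(\xi,i))$, $i\in\{1,\dots,\dim_M(\xi)-c+1\}$. For $g\colon M^k\to N$, $\mathrm{Stride}_g$ is defined on signals whose length is a positive multiple of $k$ by $\mathrm{Stride}_g(\xi)_i:=g(\mathrm{Subsignal}_k(\xi,k(i-1)+1))$,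 $i\in\{1,\dots,\dim_M(\xi)/k\}$. Fragmented signals are matrices $\xi\in M^{a\times b}$ ($b$ columns = fragments, each with $a$ samples); $\mathrm{rdim}_M(\xi)=a$, $\mathrm{cdim}_M(\xi)=b$. A signal in $M^D$ is identified with a matrix in $M^{D\times1}$. Subsignal compatible transformations and $\mathrm{Slide}$ operators are applied to a fragmented signal column by column. With $\mathrm{vec}_{a\times b}\colon M^{a\times b}\to M^{ab}$ stacking the columns on top of each other, for $k,q,s\in\mathbb{N}_1$: $\mathrm{Frag}_k\colon M^{kq\times s}\to M^{q\times ks}$, $\mathrm{Frag}_k(\xi):=(\mathrm{vec}^{-1}_{ks\times q}(\mathrm{vec}_{s\times kq}(\xi^T)))^T$, and $\mathrm{Defrag}_k\colon M^{q\times ks}\to M^{kq\times s}$, $\mathrm{Defrag}_k(\xi):=(\mathrm{vec}^{-1}_{s\times kq}(\mathrm{vec}_{ks\times q}(\xi^T)))^T$ (its inverse). For $r\in\mathbb{N}$ and a fixed arbitrary dummy element $\zeta\in M$, $\mathrm{Stuff}_r\colon\cup_1(M)\to\cup_{r+1}(M)$ appends $r$ copies of $\zeta$ at the end of a signal; $\mathrm{Trim}_r\colon\cup_{r+1}(M)\to\cup_1(M)$ removes the final $r$ samples. A processing chain consists of: $B\in\mathbb{N}_1$, a number of layers $L\in\mathbb{N}_1$, sets $M_0,\dots,M_L,N_1,\dots,N_L$, and for each $j\in\{1,\dots,L\}$ a subsignal compatible transformation $T_j\colon\cup_{c_j}(M_{j-1})\to\cup_1(N_j)$ with dimensionality reduction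 constant $c_j\in\mathbb{N}_1$ and a function $g_j\colon N_j^{k_j}\to M_j$ with $k_j\in\mathbb{N}_1$. Stride products: $k_j^*:=\prod_{\nu=1}^jk_\nu$ for $j\in\{0,\dots,L\}$ ($k_0^*=1$). Define recursively, for $\rho\in M_0^B$, $\mathrm{EvalStride}_0(\rho):=\rho$, $\mathrm{EvalStride}_j(\rho):=\mathrm{Stride}_{g_j}(T_j(\mathrm{EvalStride}_{j-1}(\rho)))$ for $j\ge1$; and for $\xi\in\cup_B(M_0)$, $\mathrm{EvalSlide}_0(\xi):=\xi$, $\mathrm{EvalSlide}_j(\xi):=\mathrm{Frag}_{k_j}(\mathrm{Slide}_{g_j}(T_j(\mathrm{EvalSlide}_{j-1}(\xi))))$ for $j\ge1$; these are well-defined only when every operator involved is applicable to its argument. The application in a strided fashion is called well-defined if for all $j\in\{1,\dots,L\}$ and all $\rho\in M_0^B$, every operator is applicable, i.e. in particular $k_j$ divides $\dim_{N_j}(T_j(\mathrm{EvalStride}_{j-1}(\rho)))$, and $\mathrm{EvalStride}_j(\rho)$ is non-empty. *)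

(* Defs.v *)
From HB Require Import structures.
From mathcomp Require Import all_boot matrix.

Set Implicit Arguments.
Unset Strict Implicit.
Unset Printing Implicit Defensive.

(* Sample positions and layers are numbered from 0 throughout.  A partial     *)
(* operator has values in option, None meaning that it is not applicable to   *)
(* its argument.                                                              *)

(* The set U_c(M) of all signals over M with at least c samples; M^q is       *)
(* q.-tuple M.                                                                *)
Record signal (c : nat) (M : Type) := Signal {
  samples :> seq M;
  samplesP : c <= size samples
}.

HB.instance Definition _ c M := [isSub for @samples c M].

Lemma tuple_size_geq c q M (x : q.-tuple M) : c <= q -> c <= size x.
Proof. by rewrite size_tuple. Qed.

Definition tuple_signal c q M (cq : c <= q) (x : q.-tuple M) : signal c M :=
  Signal (tuple_size_geq x cq).

Definition subsignal d M (s : seq M) (i : nat) : seq M := take d (drop i s).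

Lemma subsignal_size d M (s : seq M) i :
  i + d <= size s -> size (subsignal d s i) == d.
Proof.
move=> id_s; rewrite /subsignal size_takel// size_drop leq_subRL//.
exact: leq_trans (leq_addr _ _) id_s.
Qed.

Definition subsignal_tuple d M (s : seq M) i (id_s : i + d <= size s) :
  d.-tuple M := Tuple (subsignal_size id_s).

(* Below, y is Subsignal_d(x, i) regarded as an element of U_c(M).            *)
Definition subsignal_compatible c M N (T : signal c M -> signal 1 N) : Prop :=
  (forall x, size (T x) = size x - c + 1) /\
  (forall d (x y : signal c M) i, c <= d -> i + d <= size x ->
     samples y = subsignal d x i ->
     samples (T y) = subsignal (d - c + 1) (T x) i).

Lemma slide_bound c M (x : signal c M) (i : 'I_(size x - c + 1)) :
  i + c <= size x.
Proof.
case: i => i /=; rewrite addn1 ltnS => i_le.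
by rewrite addnC -leq_subRL ?samplesP.
Qed.

Definition slide_samples c M N (f : c.-tuple M -> N) (x : signal c M) : seq N :=
  [seq f (subsignal_tuple (slide_bound i)) | i : 'I_(size x - c + 1)].

Lemma slide_size c M N (f : c.-tuple M -> N) x :
  size (slide_samples f x) = size x - c + 1.
Proof. by rewrite size_image card_ord. Qed.

Lemma slide_size_gt0 c M N (f : c.-tuple M -> N) x :
  1 <= size (slide_samples f x).
Proof. by rewrite slide_size addn1. Qed.

Definition slide c M N (f : c.-tuple M -> N) (x : signal c M) : signal 1 N :=
  Signal (slide_size_gt0 f x).

Lemma stride_bound k M (s : seq M) (i : 'I_(size s %/ k)) :
  k * i + k <= size s.
Proof.
rewrite addnC -mulnS mulnC (leq_trans _ (leq_divM (size s) k))//.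
by rewrite leq_mul2r ltn_ord orbT.
Qed.

Definition stride k M N (g : k.-tuple M -> N) (s : seq M) : option (seq N) :=
  if (0 < size s) && (k %| size s) then
    Some [seq g (subsignal_tuple (stride_bound i)) | i : 'I_(size s %/ k)]
  else None.

(* Fragmented signals: the columns of the matrix are the fragments.           *)
Record fsignal (M : Type) := FSignal {
  rdim : nat;
  cdim : nat;
  fragments : 'M[M]_(rdim, cdim)
}.

Definition signal_fsignal M (s : seq M) : fsignal M :=
  FSignal (\matrix_(i < size s, j < 1) tnth (in_tuple s) i).

Definition fsignal_signal M (X : fsignal M) : option (seq M) :=
  match X with
  | @FSignal _ a 1 A => Some [seq A i ord0 | i : 'I_a]
  | _ => None
  end.

Definition fragment M a b (A : 'M[M]_(a, b)) (j : 'I_b) : a.-tuple M :=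
  [tuple A i j | i < a].

Section Columnwise.
Variables (c : nat) (M N : Type) (T : signal c M -> signal 1 N).
Hypothesis T_size : forall x, size (T x) = size x - c + 1.

Lemma tuple_apply_size a (ca : c <= a) (x : a.-tuple M) :
  size (T (tuple_signal ca x)) == a - c + 1.
Proof. by rewrite T_size size_tuple. Qed.

Definition tuple_apply a (ca : c <= a) (x : a.-tuple M) :
  (a - c + 1).-tuple N := Tuple (tuple_apply_size ca x).

Definition columnwise (X : fsignal M) : option (fsignal N) :=
  if @idP (c <= rdim X) is ReflectT cX then
    Some (FSignal (\matrix_(i < rdim X - c + 1, j < cdim X)
                     tnth (tuple_apply cX (fragment (fragments X) j)) i))
  else None.

End Columnwise.

Arguments columnwise {c M N} T T_size X.

(* mxvec lists a matrix row by row, hence the transpositions.                 *)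
Definition vec a b M (A : 'M[M]_(a, b)) : 'rV[M]_(b * a) := mxvec A^T.

Definition unvec a b M (v : 'rV[M]_(b * a)) : 'M[M]_(a, b) := (vec_mx v)^T.

Lemma frag_size k q s : k * q * s = q * (k * s).
Proof. by rewrite -mulnA mulnCA. Qed.

Definition frag_mx k q s M (A : 'M[M]_(k * q, s)) : 'M[M]_(q, k * s) :=
  (unvec (castmx (erefl, frag_size k q s) (vec A^T)))^T.

Definition defrag_mx k q s M (A : 'M[M]_(q, k * s)) : 'M[M]_(k * q, s) :=
  (unvec (castmx (erefl, esym (frag_size k q s)) (vec A^T)))^T.

(* The equation to be decided says that k divides the relevant dimension.     *)
Definition frag k M (X : fsignal M) : option (fsignal M) :=
  if (0 < rdim X) && (0 < cdim X) then
    if @eqP _ (rdim X) (k * (rdim X %/ k)) is ReflectT e then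
      Some (FSignal (frag_mx (castmx (e, erefl) (fragments X))))
    else None
  else None.

Definition defrag k M (X : fsignal M) : option (fsignal M) :=
  if (0 < rdim X) && (0 < cdim X) then
    if @eqP _ (cdim X) (k * (cdim X %/ k)) is ReflectT e then
      Some (FSignal (defrag_mx (castmx (erefl, e) (fragments X))))
    else None
  else None.

Definition stuff r M (zeta : M) (s : seq M) : seq M := s ++ nseq r zeta.

Definition trim r M (s : seq M) : option (seq M) :=
  if r < size s then Some (take (size s - r) s) else None.

Record layer (M M' : Type) := Layer {
  layN : Type;
  layc : nat;
  layk : nat;
  layc_gt0 : 0 < layc;
  layk_gt0 : 0 < layk;
  layT : signal layc M -> signal 1 layN;
  layT_compatible : subsignal_compatible layT;
  layg : layk.-tuple layN -> M'
}.

(* chM j is only meaningful for j <= chL.                                     *)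
Record chain := Chain {
  chB : nat;
  chL : nat;
  chB_gt0 : 0 < chB;
  chL_gt0 : 0 < chL;
  chM : nat -> Type;
  chlay : forall j : 'I_chL, layer (chM j) (chM j.+1)
}.

Definition layer_stride M M' (l : layer M M') (s : seq M) : option (seq M') :=
  obind (fun x : signal (layc l) M => stride (layg (l := l)) (layT x)) (insub s).

Definition layer_slide M M' (l : layer M M') (X : fsignal M) :
    option (fsignal M') :=
  obind (@frag (layk l) M')
    (obind (columnwise (slide (layg (l := l))) (slide_size (layg (l := l))))
       (columnwise (layT (l := l)) (layT_compatible l).1 X)).

Section Eval.
Variable C : chain.

Fixpoint eval_stride (j : nat) :
    j <= chL C -> (chB C).-tuple (chM C 0) -> option (seq (chM C j)) :=
  match j return
    j <= chL C -> (chB C).-tuple (chM C 0) -> option (seq (chM C j)) with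
  | 0 => fun _ rho => Some (tval rho)
  | i.+1 => fun iL rho =>
      obind (layer_stride (chlay (Ordinal iL))) (eval_stride (ltnW iL) rho)
  end.

Fixpoint eval_slide (j : nat) :
    j <= chL C -> signal (chB C) (chM C 0) -> option (fsignal (chM C j)) :=
  match j return
    j <= chL C -> signal (chB C) (chM C 0) -> option (fsignal (chM C j)) with
  | 0 => fun _ xi => Some (signal_fsignal xi)
  | i.+1 => fun iL xi =>
      obind (layer_slide (chlay (Ordinal iL))) (eval_slide (ltnW iL) xi)
  end.

Definition stride_well_defined : Prop :=
  forall j (jL : j <= chL C) (rho : (chB C).-tuple (chM C 0)), 0 < j ->
    exists2 s, eval_stride jL rho = Some s & 0 < size s.

(* The stride product of all the layers.                                      *)
Definition kstar : nat := \prod_(j < chL C) layk (chlay j).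

Definition stuffing (delta : nat) : nat :=
  if kstar %| delta - chB C + 1 then 0
  else kstar - (delta - chB C + 1) %% kstar.

Definition dense_eval (zeta : chM C 0) (xi : signal (chB C) (chM C 0)) :
    option (seq (chM C (chL C))) :=
  let r := stuffing (size xi) in
  obind (@trim r _)
    (obind (@fsignal_signal _)
       (obind (@defrag kstar _)
          (obind (eval_slide (leqnn (chL C)))
             (insub (stuff r zeta xi))))).

End Eval.

(* Main.v *)
(* Write k*_j for the product of the first j strides and u_j for the common   *)
(* length of the signals EvalStride_j(rho).  If k*_j divides D - B + 1, where *)
(* D is the length of xi, then EvalSlide_j(xi) has k*_j fragments, and        *)
(*     EvalStride_j(Subsignal_B(xi, k*_j q + l))                              *)
(*       = Subsignal_{u_j}(l-th fragment of EvalSlide_j(xi), q)               *)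
(* whenever l < k*_j and k*_j q + l <= D - B.  The induction on j rests on    *)
(* the fact that Frag_k sends the sample of index k i + a of fragment b to    *)
(* index i of fragment a s + b, where s is the number of fragments of its     *)
(* argument.  For j = L we have u_L = 1, so that defragmenting lists the      *)
(* values of EvalStride_L on all subsignals of length B of the stuffed        *)
(* signal, and trimming removes those that overlap the stuffing.              *)

Require Import Defs.
From mathcomp Require Import all_boot matrix zify.

Set Implicit Arguments.
Unset Strict Implicit.
Unset Printing Implicit Defensive.

(** The sliding evaluation computes the strided values for all starting positions at once. By
    subsignal compatibility, [layT] sends a window of a fragment to a window of its image; striding
    that window reads the slid signal at every k-th place ([onth_stride_subsignal]), and Frag
    gathers these places into a contiguous stretch of a new fragment ([frag_some]). Hence one layer
    keeps strided values visible as windows of fragments ([layer_slide_some]), and [eval_slide_some]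
    iterates this. At the end the windows have length 1, Defrag interleaves the fragments
    ([defrag_signal_some]), and the samples that survive trimming come from windows clear of the
    stuffing. So the operator slides the strided evaluation, and sliding is always compatible
    ([slide_compatible]). *)

(** * Row-major ranks of matrix entries *)

Lemma index_allpairs (S T : eqType) (s : seq S) (t : seq T) x y :
  x \in s -> y \in t ->
  index (x, y) [seq (u, v) | u <- s, v <- t] = index x s * size t + index y t.
Proof.
elim: s => //= z s IHs; rewrite inE index_cat eq_sym.
case: eqVneq => [-> _ yt | zx /= xs yt].
  by rewrite map_f// index_map// => ? ? [].
rewrite size_map IHs// ifF ?mulSn ?addnA//.
by apply/mapP=> -[v _ [/eqP]]; rewrite eq_sym (negPf zx).
Qed.

Lemma mxvec_index_val m n (i : 'I_m) (j : 'I_n) :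
  mxvec_index i j = i * n + j :> nat.
Proof.
rewrite /= /enum_rank enum_rank_in.unlock insubdK; last first.
  by rewrite unfold_in /= cardE index_mem mem_enum.
(* Unlocking exposes the enumeration of pairs as a lexicographic list of all pairs. *)
rewrite enumT Finite.enum.unlock /=.
by rewrite index_allpairs ?mem_enum// !index_enum_ord size_enum_ord.
Qed.

Lemma mxvec_val R m n (A : 'M[R]_(m, n)) (r : 'I_(m * n))
  (i : 'I_m) (j : 'I_n) :
  r = i * n + j :> nat -> mxvec A ord0 r = A i j.
Proof.
move=> rE; rewrite -(mxvecE A); congr (mxvec A _ _).
by apply: ord_inj; rewrite mxvec_index_val.
Qed.

(** The transposes cancel those inside [vec] and [unvec], so Frag and Defrag keep the row-major list
    of entries and only change the row length. *)
Lemma frag_mxE k q s M (A : 'M[M]_(k * q, s))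
  (i : 'I_q) (j : 'I_(k * s)) (i' : 'I_(k * q)) (j' : 'I_s) :
  i * (k * s) + j = i' * s + j' -> frag_mx A i j = A i' j'.
Proof.
move=> ij; rewrite /frag_mx /unvec /vec !trmxK mxE castmxE !ord1.
by apply: mxvec_val => /=; rewrite -ij -mxvec_index_val.
Qed.

Lemma defrag_mxE k q s M (A : 'M[M]_(q, k * s))
  (i : 'I_(k * q)) (j : 'I_s) (i' : 'I_q) (j' : 'I_(k * s)) :
  i * s + j = i' * (k * s) + j' -> defrag_mx A i j = A i' j'.
Proof.
move=> ij; rewrite /defrag_mx /unvec /vec !trmxK mxE castmxE !ord1.
by apply: mxvec_val => /=; rewrite -ij -mxvec_index_val.
Qed.

(* Fragments are read with natural indices, and their samples with onth, to   *)
(* stay clear of the dependent sizes; the junk value [::] is out of range.    *)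
Definition fcol M (X : fsignal M) (l : nat) : seq M :=
  if insub l is Some j then fragment (fragments X) j else [::].

Lemma fcol_ord M (X : fsignal M) (j : 'I_(cdim X)) :
  fcol X j = fragment (fragments X) j.
Proof. by rewrite /fcol valK. Qed.

Lemma size_fcol M (X : fsignal M) l : l < cdim X -> size (fcol X l) = rdim X.
Proof. by move=> lX; rewrite (fcol_ord (Ordinal lX)) size_tuple. Qed.

Lemma onth_fcol M (X : fsignal M) (i : 'I_(rdim X)) (j : 'I_(cdim X)) :
  onth (fcol X j) i = Some (fragments X i j).
Proof. by rewrite fcol_ord; apply/tnth_onth; rewrite tnth_mktuple. Qed.

Lemma fcol_signal_fsignal M (s : seq M) : fcol (signal_fsignal s) 0 = s.
Proof.
rewrite (fcol_ord (X := signal_fsignal s) ord0).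
rewrite -[RHS](map_tnth_enum (in_tuple s)).
by apply: eq_map => i; rewrite mxE.
Qed.

(** * Operators on fragmented signals, fragment by fragment *)

Lemma columnwise_some c M N (T : signal c M -> signal 1 N) Ts (X : fsignal M) :
  c <= rdim X -> exists Y,
  [/\ columnwise T Ts X = Some Y, rdim Y = rdim X - c + 1, cdim Y = cdim X
    & forall l (x : signal c M), l < cdim X -> samples x = fcol X l ->
      fcol Y l = T x].
Proof.
move=> cX; rewrite /columnwise; case: {-}_ / idP => // cX'.
eexists; split => // l x lX xE.
rewrite (fcol_ord (X := FSignal _) (Ordinal (lX : l < cdim (FSignal _)))) /=.
rewrite (_ : x = tuple_signal cX' (fragment (fragments X) (Ordinal lX))).
  rewrite -[RHS](map_tnth_enum (tuple_apply Ts cX' _)).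
  by apply: eq_map => i; rewrite mxE.
by apply: val_inj; rewrite /= xE (fcol_ord (Ordinal lX)).
Qed.

Lemma frag_some k M (X : fsignal M) :
  0 < rdim X -> 0 < cdim X -> k %| rdim X -> exists Y,
  [/\ frag k X = Some Y, rdim Y = rdim X %/ k, cdim Y = k * cdim X
    & forall i l, i < rdim Y -> l < cdim Y ->
      onth (fcol Y l) i = onth (fcol X (l %% cdim X)) (k * i + l %/ cdim X)].
Proof.
move=> X0 X0' kX; rewrite /frag X0 X0' /=; case: eqP => [e|]; last first.
  by rewrite mulnC divnK.
eexists; split => // i l iY lY.
rewrite (onth_fcol (X := FSignal _) (Ordinal iY) (Ordinal lY)).
have lX : l %% cdim X < cdim X by rewrite ltn_mod.
have iX : k * i + l %/ cdim X < rdim X.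
  have : l %/ cdim X < k by rewrite ltn_divLR.
  move: iY => /=; set q := rdim X %/ k; nia.
rewrite (onth_fcol (Ordinal iX) (Ordinal lX)); congr Some.
have iX' : k * i + l %/ cdim X < k * (rdim X %/ k) by rewrite -e.
rewrite /= (@frag_mxE _ _ _ _ _ _ _ (Ordinal iX') (Ordinal lX)).
  by rewrite castmxE; congr (fragments X _ _); apply: ord_inj.
(* The two row-major ranks agree once [l] is divided by the old number of fragments. *)
rewrite /= {1}(divn_eq l (cdim X)); nia.
Qed.

(** The column count is a variable because Defrag yields [cdim X %/ cdim X] columns, which is 1 only
    propositionally. *)
Lemma fsignal_signal1 M a b (A : 'M[M]_(a, b)) (j : 'I_b) :
  b = 1 -> fsignal_signal (FSignal A) = Some [seq A i j | i : 'I_a].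
Proof. by move=> b1; subst b; rewrite (ord1 j). Qed.

Lemma onth_image n M (f : 'I_n -> M) (i : 'I_n) :
  onth [seq f i | i : 'I_n] i = Some (f i).
Proof.
by apply/(tnth_onth _ [tuple f j | j < n]); rewrite tnth_mktuple.
Qed.

Lemma defrag_signal_some M (X : fsignal M) :
  0 < rdim X -> 0 < cdim X -> exists s,
  [/\ obind (@fsignal_signal M) (defrag (cdim X) X) = Some s,
      size s = cdim X * rdim X
    & forall n, n < size s ->
      onth s n = onth (fcol X (n %% cdim X)) (n %/ cdim X)].
Proof.
move=> X0 X0'; rewrite /defrag X0 X0' /=; case: eqP => [e|]; last first.
  by rewrite divnn X0' muln1.
have k1 : cdim X %/ cdim X = 1 by rewrite divnn X0'.
have j : 'I_(cdim X %/ cdim X) by rewrite k1; exact: ord0.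
exists [seq defrag_mx (castmx (erefl, e) (fragments X)) i j
         | i : 'I_(cdim X * rdim X)].
split; first exact: fsignal_signal1.
  by rewrite size_image card_ord.
move=> n; rewrite size_image card_ord => nX.
have lX : n %% cdim X < cdim X by rewrite ltn_mod.
have iX : n %/ cdim X < rdim X by rewrite ltn_divLR// mulnC.
rewrite (onth_fcol (Ordinal iX) (Ordinal lX)).
rewrite -[X in onth _ X]/(nat_of_ord (Ordinal nX)) onth_image.
have lX' : n %% cdim X < cdim X * (cdim X %/ cdim X) by rewrite -e.
rewrite (@defrag_mxE _ _ _ _ _ _ _ (Ordinal iX) (Ordinal lX')).
  by rewrite castmxE; congr (Some (fragments X _ _)); apply: ord_inj.
(* [j] is opaque; its value follows from there being a single column. *)
have -> : nat_of_ord j = 0.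
  by move: (ltn_ord j); rewrite {2}k1; case: (nat_of_ord j).
by rewrite /= -e k1 muln1 addn0 -divn_eq.
Qed.

(** * Windows, sliding and striding *)

Lemma subsignal_subsignal e d M (s : seq M) i j :
  j + e <= d -> subsignal e (subsignal d s i) j = subsignal e s (i + j).
Proof.
move=> jed; have jd := leq_trans (leq_addr e j) jed.
rewrite /subsignal -[X in drop j (take X _)](subnK jd).
rewrite -take_drop take_takel ?drop_drop ?[j + i]addnC//.
by rewrite leq_subRL.
Qed.

Lemma onth_subsignal d M (s : seq M) i j :
  j < d -> onth (subsignal d s i) j = onth s (i + j).
Proof.
move=> jd; rewrite !onthE /subsignal map_take map_drop nth_take// nth_drop//.
Qed.

Lemma onth_slide c M N (f : c.-tuple M -> N) (x : signal c M) n
    (nx : n + c <= size x) :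
  onth (slide f x) n = Some (f (subsignal_tuple nx)).
Proof.
have nx' : n < size x - c + 1 by move: (samplesP x); lia.
rewrite -[LHS]/(onth (slide_samples f x) (Ordinal nx')) onth_image.
by congr (Some (f _)); apply: val_inj.
Qed.

Lemma onth_stride k M N (g : k.-tuple M -> N) s t m (ms : k * m + k <= size s) :
  stride g s = Some t -> m < size t ->
  onth t m = Some (g (subsignal_tuple ms)).
Proof.
rewrite /stride; case: ifP => // _ [<-]; rewrite size_image card_ord => mt.
rewrite -[m in onth _ m]/(nat_of_ord (Ordinal mt)) onth_image.
by congr (Some (g _)); apply: val_inj.
Qed.

Lemma size_stride k M N (g : k.-tuple M -> N) s t :
  stride g s = Some t -> [/\ 0 < size s, k %| size s & size t = size s %/ k].
Proof.
rewrite /stride; case: ifP => // /andP[s0 ks] [<-].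
by rewrite size_image card_ord.
Qed.

Lemma onth_stride_subsignal k M N (g : k.-tuple M -> N) (y : signal k M)
  d q t m :
  q + d <= size y -> stride g (subsignal d y q) = Some t -> m < size t ->
  onth t m = onth (slide g y) (q + k * m).
Proof.
move=> qdy gt mt; have [_ kd tE] := size_stride gt.
have sd := eqP (subsignal_size qdy).
have md : k * m + k <= d.
  rewrite sd in kd tE.
  by rewrite -mulnSr -(divnK kd) mulnC leq_mul2r -tE mt orbT.
rewrite (onth_stride _ gt mt) ?sd// => ms.
rewrite (onth_slide g (n := q + k * m)); first lia.
move=> ny; congr (Some (g _)); apply: val_inj => /=.
by rewrite subsignal_subsignal.
Qed.

Lemma slide_compatible c M N (f : c.-tuple M -> N) :
  subsignal_compatible (slide f).
Proof.
split=> [x|d x y i cd idx yE]; first exact: slide_size.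
have sy : size y = d by rewrite yE; apply/eqP/subsignal_size.
have sf : size (subsignal (d - c + 1) (slide f x) i) = d - c + 1.
  apply/eqP/subsignal_size; rewrite /= slide_size; lia.
apply: eq_from_onth_le => n; rewrite sf [size _]slide_size sy maxnn => nd.
rewrite onth_subsignal//.
have ny : n + c <= size y by rewrite sy; lia.
have nx : i + n + c <= size x by lia.
rewrite (onth_slide _ ny) (onth_slide _ nx); congr (Some (f _)).
apply: val_inj => /=; rewrite yE subsignal_subsignal//; lia.
Qed.

(** * One layer *)

Lemma layer_stride_inv M M' (l : layer M M') s t :
  layer_stride l s = Some t ->
  exists2 x : signal (layc l) M,
    samples x = s & stride (@layg _ _ l) (layT x) = Some t.
Proof. by rewrite /layer_stride; case: insubP => //= x _ <- tE; exists x. Qed.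

Lemma size_layer_stride M M' (l : layer M M') s t :
  layer_stride l s = Some t ->
  layc l <= size s /\ size s - layc l + 1 = layk l * size t.
Proof.
move=> /layer_stride_inv[x <- /size_stride[_ kx ->]].
by rewrite samplesP mulnC divnK// (layT_compatible l).1.
Qed.

(* The shape rdim X = k n + u - 1 says that a fragment has exactly k n        *)
(* subsignals of length u.                                                    *)
Lemma layer_slide_some M M' (l : layer M M') (X : fsignal M) u v n :
  layc l <= u -> u - layc l + 1 = layk l * v -> 0 < v -> 0 < n ->
  rdim X = layk l * n + u - 1 -> 0 < cdim X -> exists Z,
  [/\ layer_slide l X = Some Z, rdim Z = n + v - 1, cdim Z = layk l * cdim X
    & forall q j t, q < n -> j < cdim Z ->
      layer_stride l (subsignal u (fcol X (j %% cdim X))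
                        (layk l * q + j %/ cdim X)) = Some t ->
      t = subsignal v (fcol Z j) q].
Proof.
set c := layc l; set k := layk l => cu uE v0 n0 rX X0.
have k0 : 0 < k := layk_gt0 l.
have kn0 : 0 < k * n by rewrite muln_gt0 k0.
have kv0 : 0 < k * v by rewrite muln_gt0 k0.
have cX : c <= rdim X by lia.
rewrite /layer_slide.
have [Y [-> rY cY fY]] := columnwise_some (layT_compatible l).1 cX.
have kY : k <= rdim Y by rewrite rY rX; nia.
rewrite /=.
have [W [-> rW cW fW]] :=
  columnwise_some (T := slide (@layg _ _ l)) (slide_size (@layg _ _ l)) kY.
have rWE : rdim W = (n + v - 1) * k by rewrite rW rY rX; nia.
have W0 : 0 < rdim W by rewrite rWE; nia.
have W0' : 0 < cdim W by rewrite cW cY.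
have kW : k %| rdim W by rewrite rWE dvdn_mull.
have [Z [/= -> rZ cZ fZ]] := frag_some W0 W0' kW.
exists Z; split=> //; first by rewrite rZ rWE mulnK.
  by rewrite cZ cW cY.
move=> q j t qn jZ /layer_stride_inv[x xE tE].
have jX : j %% cdim X < cdim X by rewrite ltn_mod.
have ja : j %/ cdim X < k by rewrite ltn_divLR// -cY -cW -cZ.
have kq : k * q + k <= k * n by rewrite -mulnSr leq_mul2l qn orbT.
set q' := k * q + j %/ cdim X in xE; set jm := j %% cdim X in jX xE.
have q'u : q' + u <= rdim X by rewrite rX /q'; lia.
have sX := size_fcol jX.
have cs : c <= size (fcol X jm) by rewrite sX.
(* The image of the window at [q'] is a window of length [u - c + 1], that is [k * v], in fragment
   [jm] of [Y]. *)
have TxE := (layT_compatible l).2 u (Signal cs) x q' cu.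
rewrite /= sX in TxE; move/(_ q'u xE): TxE => TxE.
have jY : jm < cdim Y by rewrite cY.
have ks : k <= size (fcol Y jm) by rewrite size_fcol.
have YE : fcol Y jm = layT (Signal cs) by apply: fY.
have WE : fcol W jm = slide (@layg _ _ l) (Signal ks) by apply: fW.
rewrite TxE uE -YE in tE.
have q'v : q' + k * v <= size (Signal ks).
  by rewrite /= size_fcol// rY rX /q'; lia.
have st : size t = v.
  have [_ _ ->] := size_stride tE.
  by rewrite (eqP (subsignal_size q'v)) mulKn.
have qZ : q + v <= size (fcol Z j) by rewrite size_fcol// rZ rWE mulnK//; lia.
apply: eq_from_onth_le => m.
rewrite st (eqP (subsignal_size qZ)) maxnn => mv.
rewrite onth_subsignal// fZ//; last by rewrite rZ rWE mulnK//; lia.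
(* Frag took sample [q + m] of fragment [j] from index [k * (q + m) + j %/ cdim X], which is
   [q' + k * m], the place read by the stride. *)
rewrite cW cY -/jm WE (onth_stride_subsignal q'v tE) ?st//.
by congr onth; rewrite /q'; lia.
Qed.

(** * Induction over the layers *)

Definition kprod (C : chain) j (jL : j <= chL C) :=
  \prod_(i < j) layk (chlay (widen_ord jL i)).

Lemma kprodS (C : chain) j (jL : j < chL C) :
  kprod jL = layk (chlay (Ordinal jL)) * kprod (ltnW jL).
Proof.
rewrite /kprod big_ord_recr /= mulnC; congr (_ * _).
  by congr (layk (chlay _)); apply: val_inj.
by apply: eq_bigr => i _; congr (layk (chlay _)); apply: val_inj.
Qed.

Lemma kprod_gt0 (C : chain) j (jL : j <= chL C) : 0 < kprod jL.
Proof. by apply: prodn_gt0 => i; exact: layk_gt0. Qed.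

Lemma kprod_leqnn (C : chain) : kprod (leqnn (chL C)) = kstar C.
Proof. by apply: eq_bigr => i _; congr (layk (chlay _)); apply: val_inj. Qed.

Lemma eval_stride_some (C : chain) (strideC : stride_well_defined C)
    j (jL : j <= chL C) rho :
  exists2 s, eval_stride jL rho = Some s & 0 < size s.
Proof.
case: j jL => [|j] jL; last exact: strideC.
by exists (tval rho) => //; rewrite size_tuple chB_gt0.
Qed.

(** At each layer the common length [u] is read off the evaluation of [rho0]. Lengths and windows
    share one induction because a layer step needs the common length of its inputs. *)
Lemma eval_slide_some (C : chain) (rho0 : (chB C).-tuple (chM C 0))
    (strideC : stride_well_defined C) j (jL : j <= chL C) :
  exists2 u, 0 < u &
  (forall rho s, eval_stride jL rho = Some s -> size s = u) /\
  forall (xi : signal (chB C) (chM C 0)) n,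
    size xi - chB C + 1 = kprod jL * n -> exists X,
  [/\ eval_slide jL xi = Some X, rdim X = n + u - 1, cdim X = kprod jL
    & forall q l (rho : (chB C).-tuple (chM C 0)), q < n -> l < kprod jL ->
      tval rho = subsignal (chB C) xi (kprod jL * q + l) ->
      eval_stride jL rho = Some (subsignal u (fcol X l) q)].
Proof.
elim: j jL => [|j IHj] jL.
  exists (chB C); first exact: chB_gt0.
  split=> [rho s [<-]|xi n]; first exact: size_tuple.
  rewrite /kprod big_ord0 mul1n => nE.
  exists (signal_fsignal xi); split=> //=.
    by move: (samplesP xi) (chB_gt0 C); lia.
  move=> q [|//] rho qn _ rhoE.
  by rewrite fcol_signal_fsignal rhoE mul1n addn0.
have [u u0 [uE IH]] := IHj (ltnW jL).
set l := chlay (Ordinal jL).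
have stepE rho s t : eval_stride (ltnW jL) rho = Some s ->
    eval_stride jL rho = Some t ->
    layc l <= u /\ u - layc l + 1 = layk l * size t.
  by move=> sE /=; rewrite sE /= -(uE _ _ sE); exact: size_layer_stride.
have [s0 s0E _] := eval_stride_some strideC (ltnW jL) rho0.
have [t0 t0E t00] := eval_stride_some strideC jL rho0.
have [cu vE] := stepE _ _ _ s0E t0E.
exists (size t0) => //; split=> [rho t tE|xi n].
  have [s sE _] := eval_stride_some strideC (ltnW jL) rho.
  (* Both lengths times the stride equal [u - layc l + 1]; cancelling the stride makes the length
     independent of [rho]. *)
  have [_ /eqP] := stepE _ _ _ sE tE.
  by rewrite vE eqn_pmul2l ?layk_gt0// => /eqP.
rewrite kprodS -/l -mulnA mulnCA => nE.
have n0 : 0 < n.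
  by rewrite lt0n; apply/eqP => n0; move: nE; rewrite n0 !muln0 addn1.
have [X [XE rX cX fX]] := IH xi _ nE.
have X0 : 0 < cdim X by rewrite cX kprod_gt0.
have [Z [ZE rZ cZ fZ]] := layer_slide_some cu vE t00 n0 rX X0.
exists Z; rewrite /= XE /= ZE rZ cZ cX; split=> // q m rho qn mk rhoE.
have [t tE _] := eval_stride_some strideC jL rho.
rewrite /= in tE; rewrite tE; congr Some.
apply: fZ => //; first by rewrite cZ cX.
move: tE; rewrite (fX (layk l * q + m %/ cdim X) (m %% cdim X))//.
- have : m %/ cdim X < layk l by rewrite ltn_divLR// cX.
  have : layk l * q + layk l <= layk l * n by rewrite -mulnSr leq_mul2l qn orbT.
  by lia.
- by rewrite -cX ltn_mod.
(* With s = [cdim X] and k the stride: k s q + m = s (k q + m / s) + m mod s. *)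
- rewrite rhoE -cX mulnDr -addnA [_ * (_ %/ _)]mulnC -divn_eq mulnA.
  by rewrite [cdim X * _]mulnC.
Qed.

(** * Stuffing, trimming and the conclusion *)

Lemma subsignal_stuff r B M (zeta : M) s i :
  i + B <= size s -> subsignal B (stuff r zeta s) i = subsignal B s i.
Proof.
move=> iB; rewrite /subsignal /stuff drop_cat; case: ltnP => [si|si].
  by rewrite takel_cat// size_drop leq_subRL// ltnW.
have -> : B = 0 by lia.
by rewrite !take0.
Qed.

Lemma dvdn_stuffing C delta : kstar C %| delta - chB C + 1 + stuffing C delta.
Proof.
rewrite /stuffing; case: ifP => [|_]; first by rewrite addn0.
set a := delta - _ + 1; have k0 : 0 < kstar C by rewrite -kprod_leqnn kprod_gt0.
rewrite {1}(divn_eq a (kstar C)) -addnA subnKC; last by rewrite ltnW// ltn_mod.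
by rewrite dvdn_addr ?dvdn_mull.
Qed.

Theorem theorem4 (C : chain) (zeta : chM C 0)
  (strideC : stride_well_defined C)
  (dim1 : forall (rho : (chB C).-tuple (chM C 0)) (s : seq (chM C (chL C))),
     eval_stride (leqnn (chL C)) rho = Some s -> size s = 1) :
  exists (T : signal (chB C) (chM C 0) -> signal 1 (chM C (chL C)))
         (evalL : (chB C).-tuple (chM C 0) -> chM C (chL C)),
  [/\ forall xi, dense_eval zeta xi = Some (samples (T xi)),
      subsignal_compatible T,
      forall rho, eval_stride (leqnn (chL C)) rho
                  = Some (samples (T (tuple_signal (leqnn (chB C)) rho))),
      forall rho, eval_stride (leqnn (chL C)) rho = Some [:: evalL rho]
    & T =1 slide evalL].
Proof.
(* The dummy element gives an input, whose nonempty evaluation supplies the default [y0] for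
   [head]. *)
have rho0 : (chB C).-tuple (chM C 0) := [tuple zeta | _ < chB C].
have [s0 s0E] := eval_stride_some strideC (leqnn (chL C)) rho0.
case: s0 s0E => // y0 s0 _ _.
pose evalL rho := head y0 (odflt [::] (eval_stride (leqnn (chL C)) rho)).
have evalLE rho : eval_stride (leqnn (chL C)) rho = Some [:: evalL rho].
  have [s sE _] := eval_stride_some strideC (leqnn (chL C)) rho.
  by rewrite /evalL sE /=; move: (dim1 _ _ sE); case: (s) => [|y []].
exists (slide evalL), evalL; split=> //; last 2 first.
- exact: slide_compatible.
- move=> rho; rewrite evalLE; congr Some; apply: eq_from_onth_le => n.
  set x := tuple_signal _ _; have sx : size x = chB C := size_tuple rho.
  rewrite slide_size sx subnn; case: n => // _.
  have nx : 0 + chB C <= size x by rewrite sx.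
  rewrite (onth_slide _ nx) /=; congr (Some (evalL _)); apply: val_inj.
  by rewrite /= /subsignal drop0 take_oversize ?size_tuple.
move=> xi; rewrite /dense_eval; set r := stuffing C (size xi).
have xiB := samplesP xi.
case: insubP => [xi' _ xi'E /=|]; last first.
  by rewrite size_cat (leq_trans xiB)// leq_addr.
have sxi' : size xi' = size xi + r by rewrite xi'E size_cat size_nseq.
(* Stuffing makes the number of windows a multiple of the stride product; the quotient [n] is the
   final fragment length. *)
have [n nE] : exists n, size xi' - chB C + 1 = kprod (leqnn (chL C)) * n.
  have /dvdnP[n nE] := dvdn_stuffing C (size xi).
  by exists n; rewrite kprod_leqnn mulnC -nE -/r sxi'; lia.
have [u u0 [uE /(_ _ _ nE)[X [-> rX cX fX]]]] :=
  eval_slide_some rho0 strideC (leqnn (chL C)).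
have {uE} u1 : u = 1 by rewrite -(uE _ _ (evalLE rho0)).
rewrite {u u0}u1 addnK in rX fX.
rewrite kprod_leqnn in nE cX fX.
have X0 : 0 < cdim X by rewrite cX -kprod_leqnn kprod_gt0.
have X0' : 0 < rdim X.
  by rewrite rX lt0n; apply/eqP => n0; move: nE; rewrite n0 muln0 addn1.
have [s] := defrag_signal_some X0' X0; rewrite cX /= rX => -[-> sE fs] /=.
rewrite -nE sxi' in sE.
rewrite /trim ifT; last by rewrite sE; lia.
congr Some; apply: eq_from_onth_le => i.
have rs : size s - r = size xi - chB C + 1 by rewrite sE; lia.
rewrite rs slide_size size_takel ?maxnn ?sE; last by lia.
move=> ixi; have ix : i + chB C <= size xi by lia.
have -> : onth (take (size xi - chB C + 1) s) i = onth s i.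
  by have := onth_subsignal s 0 ixi; rewrite /subsignal drop0.
rewrite (onth_slide _ ix) fs; last by rewrite sE; lia.
have k0 : 0 < kstar C by rewrite -cX.
(* The window at [i] ends inside [xi], so stuffing leaves it unchanged; quotient and remainder of
   [i] are its position and its fragment. *)
have xi'i : subsignal (chB C) xi i =
    subsignal (chB C) xi' (kstar C * (i %/ kstar C) + i %% kstar C).
  by rewrite mulnC -divn_eq xi'E subsignal_stuff.
have ik : i %/ kstar C < n by rewrite ltn_divLR// mulnC -nE sxi'; lia.
have := fX _ _ (subsignal_tuple ix) ik (ltn_pmod i k0) xi'i.
rewrite evalLE => -[/(congr1 (fun t => onth t 0))].
by rewrite onth_subsignal// addn0 => <-.
Qed.
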